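(* Let $(\overline{M},\overline{g},J)$ be a locally metallic (or locally Golden) Riemannian manifold and let $M:=M_{T}\times_f M_{\theta}$ be a warped product semi-slant submanifold in $\overline{M}$, where $M_{T}$ is an invariant submanifold and $M_{\theta}$ is a proper slant submanifold in $\overline{M}$ with slant angle $\theta\in(0,\frac{\pi}{2})$. Then $M$ is a non proper warped product submanifold in $\overline{M}$, i.e. the warping function $f$ is constant on the connected components of $M_{T}$.
   Context: Let $p,q$ be positive integers. A metallic Riemannian manifold $(\overline{M},\overline{g},J)$ is a Riemannian manifold with a $(1,1)$-tensor field $J$ satisfying $J^{2}=pJ+qI$ and $\overline{g}(JX,Y)=\overline{g}(X,JY)$ for all vector fields $X,Y$; for $p=q=1$ it is called Golden. It is locally metallic (locally Golden) if $\overline{\nabla}J=0$, where $\overline{\nabla}$ is the Levi-Civita connection of $\overline{g}$. For Riemannian manifolds $(M_1,g_1)$, $(M_2,g_2)$ of positive dimension and a smooth $f:M_1\to(0,\infty)$, the warped product $M_1\times_f M_2$ is $M_1\times M_2$ with metric $g=\pi_1^*g_1+(f\circ\pi_1)^2\pi_2^*g_2$, where $\pi_i$ are the projections. A warped product submanifold $M=M_1\times_f M_2$ of $\overline{M}$ is a warped product isometrically immersed in $(\overline{M},\overline{g})$. Write $D_1,D_2$ for the orthogonal distributions on $M$ tangent to the first and second factor. The factor $M_i$ is invariant in $\overline{M}$ if $J(D_i)=D_i$. The factor $M_i$ is slant in $\overline{M}$ with slant angle $\theta$ if for every $x\in M$ and every nonzero $X_x\in (D_i)_x$ the angle between $JX_x$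 and the subspace $(D_i)_x$ equals the constant $\theta$; it is proper slant if $\theta\in(0,\frac{\pi}{2})$. A warped product semi-slant submanifold is one with one factor invariant and the other slant. *)

(* Defs.v *)
From HB Require Import structures.
From mathcomp Require Import all_boot all_order all_algebra.
From mathcomp Require Import all_classical all_reals all_analysis.

Set Implicit Arguments.
Unset Strict Implicit.
Unset Printing Implicit Defensive.

Import Order.TTheory GRing.Theory Num.Theory.
Import numFieldNormedType.Exports.
Local Open Scope classical_set_scope.
Local Open Scope ring_scope.

(* Tangent vectors are row vectors of components in a chart. A linear map acts
   on them by right multiplication, so with [jacobian] the differential of [h]
   at [u] is [v |-> v *m jacobian h u], and composition of maps reads from
   left to right. *)

(* [A] is meant to be open. *)
Fixpoint Ck_on (R : realType) (V W : normedModType R) (k : nat) (A : set V)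
    (h : V -> W) : Prop :=
  match k with
  | 0%N => forall x, A x -> {for x, continuous h}
  | k'.+1 => (forall x, A x -> differentiable h x) /\
             (forall v : V, Ck_on k' A (fun x => 'd h x v))
  end.

Definition smooth_on (R : realType) (V W : normedModType R) (A : set V)
    (h : V -> W) : Prop :=
  forall k, Ck_on k A h.

(* The data of an atlas on [T], modelled on ['rV_n]. The chart [i] is the
   restriction of [coord i] to [dom i], with inverse [point i]; the values of
   these functions outside [dom i] and [cod i] are irrelevant. *)
Record atlas (R : realType) (T : topologicalType) (n : nat) := Atlas {
  chart : Type;
  dom : chart -> set T;
  coord : chart -> T -> 'rV[R]_n;
  point : chart -> 'rV[R]_n -> T }.

Arguments chart {R T n} _.
Arguments dom {R T n} _ _.
Arguments coord {R T n} _ _ _.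
Arguments point {R T n} _ _ _.

Definition cod (R : realType) (T : topologicalType) (n : nat)
    (A : atlas R T n) (i : chart A) : set 'rV[R]_n :=
  coord A i @` dom A i.

Definition overlap (R : realType) (T : topologicalType) (n : nat)
    (A : atlas R T n) (i j : chart A) : set 'rV[R]_n :=
  [set u | cod i u /\ dom A j (point A i u)].

Definition transition (R : realType) (T : topologicalType) (n : nat)
    (A : atlas R T n) (i j : chart A) (u : 'rV[R]_n) : 'rV[R]_n :=
  coord A j (point A i u).

Record is_manifold (R : realType) (T : topologicalType) (n : nat)
    (A : atlas R T n) : Prop := IsManifold {
  manifold_hausdorff : hausdorff_space T;
  manifold_second_countable : @second_countable T;
  manifold_nonempty : [set: T] !=set0;
  chart_cover : forall x : T, exists i, dom A i x;
  chart_dom_open : forall i, open (dom A i);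
  chart_cod_open : forall i : chart A, open (cod i);
  chart_inverse : forall i x, dom A i x -> point A i (coord A i x) = x;
  chart_continuous : forall i x, dom A i x -> {for x, continuous (coord A i)};
  chart_inverse_continuous :
    forall i u, cod i u -> {for u, continuous (point A i)};
  transition_smooth :
    forall i j : chart A, smooth_on (overlap i j) (transition i j) }.

(* The standard atlas of the product manifold. *)
Definition prod_atlas (R : realType) (T1 T2 : topologicalType) (n1 n2 : nat)
    (A1 : atlas R T1 n1) (A2 : atlas R T2 n2) :
    atlas R (T1 * T2)%type (n1 + n2) :=
  {| chart := (chart A1 * chart A2)%type;
     dom := fun i => dom A1 i.1 `*` dom A2 i.2;
     coord := fun i x => row_mx (coord A1 i.1 x.1) (coord A2 i.2 x.2);
     point := fun i u => (point A1 i.1 (lsubmx u), point A2 i.2 (rsubmx u)) |}.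

Definition smooth_fun (R : realType) (T : topologicalType) (n : nat)
    (A : atlas R T n) (f : T -> R) : Prop :=
  forall i : chart A, smooth_on (cod i) (fun u => f (point A i u)).

Section Maps.
Variables (R : realType) (T S : topologicalType) (m n : nat).
Variables (A : atlas R T m) (B : atlas R S n) (F : T -> S).

Definition local_rep (i : chart A) (j : chart B) (u : 'rV[R]_m) : 'rV[R]_n :=
  coord B j (F (point A i u)).

Definition local_dom (i : chart A) (j : chart B) : set 'rV[R]_m :=
  [set u | cod i u /\ dom B j (F (point A i u))].

Definition smooth_map : Prop :=
  continuous F /\ forall i j, smooth_on (local_dom i j) (local_rep i j).

Definition dmap (i : chart A) (j : chart B) (u : 'rV[R]_m) : 'M[R]_(m, n) :=
  jacobian (local_rep i j) u.

Definition immersion : Prop :=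
  smooth_map /\ forall i j u, local_dom i j u -> row_free (dmap i j u).

End Maps.

(* Components of a (0,2)- or (1,1)-tensor field: a matrix for each chart and
   each point of its codomain. *)
Definition tensor_field (R : realType) (T : topologicalType) (n : nat)
    (A : atlas R T n) : Type :=
  chart A -> 'rV[R]_n -> 'M[R]_n.

Definition inner (R : realType) (n : nat) (G : 'M[R]_n) (X Y : 'rV[R]_n) : R :=
  (X *m G *m Y^T) 0 0.

Definition gnorm (R : realType) (n : nat) (G : 'M[R]_n) (X : 'rV[R]_n) : R :=
  Num.sqrt (inner G X X).

Section Geometry.
Variables (R : realType) (T : topologicalType) (n : nat) (A : atlas R T n).

Record is_riemannian (g : tensor_field A) : Prop := IsRiemannian {
  metric_smooth : forall i, smooth_on (cod i) (g i);
  metric_change : forall (i j : chart A) u, overlap i j u ->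
    g i u = jacobian (transition i j) u *m g j (transition i j u)
              *m (jacobian (transition i j) u)^T;
  metric_sym : forall i u, cod i u -> forall X Y : 'rV[R]_n,
    inner (g i u) X Y = inner (g i u) Y X;
  metric_pos : forall i u, cod i u -> forall X : 'rV[R]_n,
    X != 0 -> 0 < inner (g i u) X X }.

Record is_endo_field (J : tensor_field A) : Prop := IsEndoField {
  endo_smooth : forall i, smooth_on (cod i) (J i);
  endo_change : forall (i j : chart A) u, overlap i j u ->
    J i u *m jacobian (transition i j) u =
    jacobian (transition i j) u *m J j (transition i j u) }.

Record is_metallic (p q : nat) (g J : tensor_field A) : Prop := IsMetallic {
  metallic_metric : is_riemannian g;
  metallic_endo : is_endo_field J;
  metallic_eq : forall i u, cod i u ->
    J i u *m J i u = p%:R *: J i u + q%:R%:M;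
  metallic_sym : forall i u, cod i u -> forall X Y : 'rV[R]_n,
    inner (g i u) (X *m J i u) Y = inner (g i u) X (Y *m J i u) }.

(* Row [b], column [c] of [Gam i u a] is the Christoffel symbol
   Gamma^c_(a b) in the chart [i]. *)
Definition christoffel : Type := chart A -> 'rV[R]_n -> 'I_n -> 'M[R]_n.

Definition conn_form (Gam : christoffel) (i : chart A) (u v : 'rV[R]_n) :
    'M[R]_n :=
  \sum_(a < n) v 0 a *: Gam i u a.

Definition covd (Gam : christoffel) (i : chart A) (v : 'rV[R]_n)
    (Y : 'rV[R]_n -> 'rV[R]_n) (u : 'rV[R]_n) : 'rV[R]_n :=
  'D_v Y u + Y u *m conn_form Gam i u v.

(* [conn_change] says that [covd Gam i v Y u], computed in two charts, gives
   the components of the same tangent vector. *)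
Record is_connection (Gam : christoffel) : Prop := IsConnection {
  conn_smooth : forall i a, smooth_on (cod i) (fun u => Gam i u a);
  conn_change : forall (i j : chart A) u, overlap i j u ->
    forall v : 'rV[R]_n,
    conn_form Gam i u v *m jacobian (transition i j) u =
    'D_v (fun w => jacobian (transition i j) w) u +
    jacobian (transition i j) u *m
      conn_form Gam j (transition i j u) (v *m jacobian (transition i j) u) }.

Definition lie_bracket (X Y : 'rV[R]_n -> 'rV[R]_n) (u : 'rV[R]_n) :
    'rV[R]_n :=
  'D_(X u) Y u - 'D_(Y u) X u.

Definition torsion_free (Gam : christoffel) : Prop :=
  forall i (X Y : 'rV[R]_n -> 'rV[R]_n),
  smooth_on (cod i) X -> smooth_on (cod i) Y -> forall u, cod i u ->
  covd Gam i (X u) Y u - covd Gam i (Y u) X u = lie_bracket X Y u.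

Definition metric_compatible (g : tensor_field A) (Gam : christoffel) : Prop :=
  forall i (Y Z : 'rV[R]_n -> 'rV[R]_n),
  smooth_on (cod i) Y -> smooth_on (cod i) Z ->
  forall u, cod i u -> forall v : 'rV[R]_n,
  'D_v (fun w => inner (g i w) (Y w) (Z w)) u =
  inner (g i u) (covd Gam i v Y u) (Z u) +
  inner (g i u) (Y u) (covd Gam i v Z u).

Definition is_levi_civita (g : tensor_field A) (Gam : christoffel) : Prop :=
  [/\ is_connection Gam, torsion_free Gam & metric_compatible g Gam].

(* (nabla_v J) Y = nabla_v (J Y) - J (nabla_v Y) vanishes identically. *)
Definition parallel (Gam : christoffel) (J : tensor_field A) : Prop :=
  forall i (Y : 'rV[R]_n -> 'rV[R]_n), smooth_on (cod i) Y ->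
  forall u, cod i u -> forall v : 'rV[R]_n,
  covd Gam i v (fun w => Y w *m J i w) u - covd Gam i v Y u *m J i u = 0.

(* The Levi-Civita connection of a Riemannian metric exists and is unique, so
   the quantifier only names it. *)
Definition locally_metallic (p q : nat) (g J : tensor_field A) : Prop :=
  is_metallic p q g J /\
  exists2 Gam : christoffel, is_levi_civita g Gam & parallel Gam J.

End Geometry.

(* The metric pi_1^* g1 + (f \o pi_1)^2 pi_2^* g2 on the product. *)
Definition warped_metric (R : realType) (T1 T2 : topologicalType)
    (n1 n2 : nat) (A1 : atlas R T1 n1) (A2 : atlas R T2 n2)
    (g1 : tensor_field A1) (g2 : tensor_field A2) (f : T1 -> R) :
    tensor_field (prod_atlas A1 A2) :=
  fun i u => block_mx (g1 i.1 (lsubmx u)) 0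
                      0 (f (point A1 i.1 (lsubmx u)) ^+ 2 *: g2 i.2 (rsubmx u)).

(* The row space of [D i u] is the subspace of the tangent space. *)
Definition distribution (R : realType) (T : topologicalType) (n k : nat)
    (A : atlas R T n) : Type :=
  chart A -> 'rV[R]_n -> 'M[R]_(k, n).

Definition tangent_fst (R : realType) (T1 T2 : topologicalType) (n1 n2 : nat)
    (A1 : atlas R T1 n1) (A2 : atlas R T2 n2) :
    distribution n1 (prod_atlas A1 A2) :=
  fun _ _ => row_mx 1%:M 0.

Definition tangent_snd (R : realType) (T1 T2 : topologicalType) (n1 n2 : nat)
    (A1 : atlas R T1 n1) (A2 : atlas R T2 n2) :
    distribution n2 (prod_atlas A1 A2) :=
  fun _ _ => row_mx 0 1%:M.

Arguments tangent_fst {R T1 T2 n1 n2} A1 A2 _ _.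
Arguments tangent_snd {R T1 T2 n1 n2} A1 A2 _ _.

Definition orth_proj (R : realType) (n k : nat) (G : 'M[R]_n)
    (W : 'M[R]_(k, n)) (v w : 'rV[R]_n) : Prop :=
  (w <= W)%MS /\
  forall X : 'rV[R]_n, (X <= W)%MS -> inner G (v - w) X = 0.

(* For positive definite [G] the orthogonal projection of [v] exists and is
   unique; the angle is pi / 2 when it vanishes. Meant for [v != 0]. *)
Definition subspace_angle (R : realType) (n k : nat) (G : 'M[R]_n)
    (W : 'M[R]_(k, n)) (v : 'rV[R]_n) (theta : R) : Prop :=
  exists2 w, orth_proj G W v w & theta = acos (gnorm G w / gnorm G v).

Section Submanifolds.
Variables (R : realType) (T S : topologicalType) (m n k : nat).
Variables (A : atlas R T m) (B : atlas R S n) (F : T -> S).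

Definition isometric_immersion (g : tensor_field A) (gbar : tensor_field B) :
    Prop :=
  immersion A B F /\
  forall i j u, local_dom F i j u -> forall X Y : 'rV[R]_m,
  inner (g i u) X Y =
  inner (gbar j (local_rep F i j u)) (X *m dmap F i j u) (Y *m dmap F i j u).

Definition invariant_dist (J : tensor_field B) (D : distribution k A) : Prop :=
  forall i j u, local_dom F i j u ->
  (D i u *m dmap F i j u *m J j (local_rep F i j u) ==
   D i u *m dmap F i j u)%MS.

Definition slant_dist (gbar J : tensor_field B) (D : distribution k A)
    (theta : R) : Prop :=
  forall i j u, local_dom F i j u ->
  forall X : 'rV[R]_m, (X <= D i u)%MS -> X != 0 ->
  subspace_angle (gbar j (local_rep F i j u)) (D i u *m dmap F i j u)
    (X *m dmap F i j u *m J j (local_rep F i j u)) theta.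

End Submanifolds.

(* Main.v *)
Require Import Defs.
From HB Require Import structures.
From mathcomp Require Import all_boot all_order all_algebra.
From mathcomp Require Import all_classical all_reals all_analysis.
From mathcomp Require Import ring lra.
Import Order.TTheory GRing.Theory Num.Theory.
Import numFieldNormedType.Exports.
Local Open Scope classical_set_scope.
Local Open Scope ring_scope.
(* Several names of the definitions, such as point and coord, also occur in the
   libraries; the former are meant below. *)
Import Defs.

(** Let X be tangent to M_T and let Z be tangent to M_theta, constant in a
chart. Write nabla for the ambient covariant derivative along the immersion, N
for <Z, Z> = f^2 g2(Z, Z) and P for <J Z, Z>, both as functions on M. It
suffices to show that X N = 0 for some nonzero Z at each point, since then the
differential of f vanishes and f is constant on connected components.

Slantness bounds the ratio P / N. If T Z denotes the projection of J Z to the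
tangent space of M_theta, then |T Z|^2 = c |J Z|^2 = c (p P + q N) with
c = cos^2 theta, and P = <T Z, Z>, so that P^2 <= c (p P + q N) N by the
inequality of Cauchy and Schwarz: the ratio stays between the two roots of
x^2 = c (p x + q) ([slant_ineq]). Polarizing the same identity shows that T
satisfies T^2 = c (p T + q), hence has an eigenvector with one of these roots,
l, as eigenvalue ([slant_eigen]). With this eigenvector as Z at a given point,
the function P - l N has a local extremum there, so that X P = l X N at that
point.

On the other hand, J is parallel and nabla_X Z = nabla_Z X, and X and J X are
orthogonal to Z throughout M because M_T is invariant. Differentiating these
two orthogonality relations along Z gives
  X N = - 2 <X, nabla_Z Z> and X P = - 2 <J X, nabla_Z Z>.
Consequently the linear form <_, nabla_Z Z> on the tangent
space of M_T takes J X to l times its value on X, and J^2 = p J + q leaves only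
two possibilities: the form vanishes, or l^2 = p l + q ([stationary_length]).
The latter is excluded by l^2 = c (p l + q), c < 1 and q > 0
([slant_root_neq]).

The identity nabla_X Z = nabla_Z X rests on the symmetry of second derivatives,
which is obtained in [derive_sym] by Young's argument. *)

Set Implicit Arguments.
Unset Strict Implicit.
Unset Printing Implicit Defensive.

(** * Directional derivatives *)

Section Calculus.
Context {R : realType}.

Lemma is_derive_mxP (V : normedModType R) m n (M : V -> 'M[R]_(m, n)) x v D :
  is_derive x v M D <-> forall i j, is_derive x v (fun y => M y i j) (D i j).
Proof.
split=> [[dM <-] i j|dM].
  split; first exact: (derivable_mxP M x v).1.
  by rewrite derive_mx// mxE.
have dM' : derivable M x v by apply/derivable_mxP => i j; case: (dM i j).
split=> //; rewrite derive_mx//; apply/matrixP => i j; rewrite mxE.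
by case: (dM i j).
Qed.

Lemma is_derive_mulmx (V : normedModType R) m n r (A : V -> 'M[R]_(m, n))
    (B : V -> 'M[R]_(n, r)) x v dA dB :
  is_derive x v A dA -> is_derive x v B dB ->
  is_derive x v (fun y => A y *m B y) (dA *m B x + A x *m dB).
Proof.
move=> /is_derive_mxP dA' /is_derive_mxP dB'; apply/is_derive_mxP => i j.
rewrite (_ : (fun y => _) = \sum_(k < n) (fun y => A y i k * B y k j));
  last by apply/funext => y; rewrite mxE fct_sumE.
apply: is_derive_eq.
rewrite !mxE -big_split/=; apply: eq_bigr => k _.
by rewrite /GRing.scale/=; ring.
Qed.

Lemma is_derive_trmx (V : normedModType R) m n (A : V -> 'M[R]_(m, n)) x v dA :
  is_derive x v A dA -> is_derive x v (fun y => (A y)^T) dA^T.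
Proof.
move=> /is_derive_mxP dA'; apply/is_derive_mxP => i j.
rewrite (_ : (fun y => _) = (fun y => A y j i)) ?mxE//.
by apply/funext => y; rewrite mxE.
Qed.

Lemma is_derive_inner (V : normedModType R) n (G : V -> 'M[R]_n)
    (X Y : V -> 'rV[R]_n) x v dG dX dY :
  is_derive x v G dG -> is_derive x v X dX -> is_derive x v Y dY ->
  is_derive x v (fun y => inner (G y) (X y) (Y y))
    (inner dG (X x) (Y x) + inner (G x) dX (Y x) + inner (G x) (X x) dY).
Proof.
move=> dG' dX' dY'.
have dXG := is_derive_mulmx dX' dG'.
have /is_derive_mxP/(_ 0 0) d := is_derive_mulmx dXG (is_derive_trmx dY').
apply: (is_derive_eq d).
by rewrite /inner mulmxDl !mxE; ring.
Qed.

Lemma is_derive_comp_diff (U V W : normedModType R) (h : U -> V) (k : V -> W)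
    x v :
  differentiable h x -> differentiable k (h x) ->
  is_derive x v (k \o h) ('D_('D_v h x) k (h x)).
Proof.
move=> dh dk; have dkh := differentiable_comp dh dk.
split; first exact: diff_derivable.
by rewrite !deriveE// diff_comp.
Qed.

(** The sign [s] selects between a local maximum and a local minimum with
value zero. If the derivative did not vanish, [h] would have opposite strict
signs on the two sides of [x] along [v]. *)
Lemma derive_extremum (V : normedModType R) (h : V -> R) x v (s : bool) :
  derivable h x v -> (\near x, (-1) ^+ s * h x <= 0) -> h x = 0 ->
  'D_v h x = 0.
Proof.
move=> dh hle hx0; apply/eqP/negPn/negP => D0.
have hlim : (fun t : R => t^-1 *: h (t *: v + x)) @ 0^' --> 'D_v h x.
  have -> : (fun t : R => t^-1 *: h (t *: v + x)) =
      (fun t => t^-1 *: ((h \o shift x) (t *: v) - h x)).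
    by apply/funext => t; rewrite hx0 subr0.
  exact: dh.
have e0 : 0 < `|'D_v h x| by rewrite normr_gt0.
move/cvgrPdist_lt: hlim => /(_ _ e0) near1.
have near2 : \forall t \near (0 : R)^', (-1) ^+ s * h (t *: v + x) <= 0.
  have c : {for 0, continuous (fun t : R => t *: v + x)}.
    exact: differentiable_continuous.
  have {}c : (fun t : R => t *: v + x) @ (0 : R) --> x.
    by move: c; rewrite /prop_for /continuous_at /= scale0r add0r.
  have : nbhs (0 : R) [set t | (-1) ^+ s * h (t *: v + x) <= 0].
    by exact: (c _ hle).
  by apply: filterS.
have [d /= d_gt0 near12] := filterI near1 near2.
set D := 'D_v h x in D0 e0 near1 near12.
pose m := d / 2.
have m_gt0 : 0 < m by rewrite divr_gt0.
have md : m < d by rewrite /m; lra.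
have [||a1 a2] := near12 m; first by rewrite /= sub0r normrN gtr0_norm.
  by rewrite gt_eqF.
have [||b1 b2] := near12 (- m); first by rewrite /= sub0r opprK gtr0_norm.
  by rewrite oppr_eq0 gt_eqF.
have scaleE (y z : R) : y *: z = y * z by [].
move: a1 a2 b1 b2; rewrite !scaleE invrN mulNr opprK.
set a := h _; set b := h _.
have -> : a = m * (m^-1 * a) by rewrite mulrA mulfV ?mul1r// gt_eqF.
have -> : b = m * (m^-1 * b) by rewrite mulrA mulfV ?mul1r// gt_eqF.
rewrite !(mulKf (lt0r_neq0 m_gt0)); set a' := m^-1 * a; set b' := m^-1 * b.
move=> a1 a2 b1 b2.
have {}a2 : (-1) ^+ s * a' <= 0 by rewrite mulrCA pmulr_rle0 in a2.
have {}b2 : (-1) ^+ s * b' <= 0 by rewrite mulrCA pmulr_rle0 in b2.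
move: a1 b1 e0; rewrite !ltr_norml; clearbody a' b' D.
case: (ger0P D) => D1 /andP[? ?] /andP[? ?] ?;
  move: a2 b2; rewrite -signr_odd; case: (odd s) => /=;
  rewrite ?expr0 ?expr1 ?mulN1r ?mul1r => ? ?; lra.
Qed.

(** Young's argument: by the mean value theorem along [v], the second
difference over the parallelogram spanned by [s *: v] and [s *: w] is [s] times
an increment of [hv] over [s *: w], at a point within O(s) of [x], and
differentiability of [hv] at the single point [x] evaluates that increment up
to o(s). *)
Lemma second_difference (V : normedModType R) (h hv : V -> R) x v w (e : R) :
  (\forall y \near x, differentiable h y /\ 'd h y v = hv y) ->
  differentiable hv x -> 0 < e ->
  \forall s \near (0:R)^'+,
    `|h (x + s *: v + s *: w) - h (x + s *: v) - h (x + s *: w) + h x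
      - s ^+ 2 * 'd hv x w| <= e * s ^+ 2.
Proof.
move=> dh dv e0.
pose k := `|v| + `|w| + 1.
have k0 : 0 < k by rewrite ltr_wpDl// addr_ge0.
have e'0 : 0 < e / (2 * k) by rewrite divr_gt0// mulr_gt0.
have [d /= d0 H] : exists2 d, 0 < d & forall y, `|y - x| < d ->
    (differentiable h y /\ 'd h y v = hv y) /\
    `|hv y - hv x - 'd hv x (y - x)| <= e / (2 * k) * `|y - x|.
  have [_ /eqaddoP/(_ _ e'0)/nbhs_ballP[d1 /= d1_gt0 H1]] :=
    (diff_locallyP x hv).1 dv.
  have /nbhs_ballP[d2 /= d2_gt0 H2] := dh.
  exists (Num.min d1 d2); first by rewrite lt_min d1_gt0.
  move=> y; rewrite lt_min => /andP[yd1 yd2]; split.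
    by apply: H2; rewrite -ball_normE/= distrC.
  have /H1/= : ball (0 : V) d1 (y - x) by rewrite -ball_normE/= sub0r normrN.
  rewrite -![(_ - _ : _ -> _) _]/(_ - _) -![(_ + _ : _ -> _) _]/(_ + _)/=.
  by rewrite subrK opprD addrA.
near=> s.
have s0 : 0 < s by near: s; exact: nbhs_right_gt.
have sd : s * k < d.
  rewrite -ltr_pdivlMr//; near: s; apply: nbhs_right_lt; exact: divr_gt0.
have small t r : 0 <= t <= s -> 0 <= r <= s -> `|t *: v + r *: w| <= s * k.
  move=> /andP[t0 ts] /andP[r0 rs]; rewrite (le_trans (ler_normD _ _))//.
  rewrite !normrZ !ger0_norm// /k !mulrDr mulr1.
  by apply: ler_wpDr; [exact: ltW|rewrite lerD// ler_wpM2r].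
pose phi t := h (x + t *: v + s *: w) - h (x + t *: v).
pose dphi t := hv (x + t *: v + s *: w) - hv (x + t *: v).
have small' t r : 0 <= t <= s -> 0 <= r <= s ->
    `|(x + t *: v + r *: w) - x| < d.
  move=> *; rewrite -[x + _ + _]addrA addrAC subrr add0r.
  by rewrite (le_lt_trans _ sd)// small.
have dphiE t : t \in `[0, s]%R -> is_derive t 1 phi (dphi t).
  rewrite in_itv /= => ts.
  have aux z : `|(x + t *: v + z) - x| < d ->
      is_derive t 1 (fun t => h (x + t *: v + z)) (hv (x + t *: v + z)).
    move=> /H[[dz dzE] _].
    have dl : is_diff t (fun t : R => x + t *: v + z) ( *:%R^~ v).
      by apply: is_diff_eq; rewrite addr0 add0r.
    have /= H1 :=
      is_derive_comp_diff (U := R) 1 (ex_diff (is_diff_def := dl)) dz.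
    apply: (is_derive_eq H1).
    by rewrite deriveE// deriveE// diff_val/= scale1r dzE.
  have ss : 0 <= s <= s by rewrite lexx ltW.
  have s00 : 0 <= (0 : R) <= s by rewrite lexx ltW.
  have A1 := aux _ (small' _ _ ts ss).
  have A2 := aux _ (small' _ _ ts s00).
  rewrite scale0r in A2.
  have := is_deriveB A1 A2.
  by under [X in is_derive _ _ (_ - X)]eq_fun do rewrite addr0; rewrite addr0.
have dphi_oo t : t \in `]0, s[%R -> is_derive t 1 phi (dphi t).
  by move=> ts; apply: dphiE; apply: subset_itv_oo_cc.
have cphi : {within `[0, s], continuous phi}.
  by apply: derivable_within_continuous => t /dphiE[].
have [c cs] := MVT s0 dphi_oo cphi.
rewrite subr0 => E.
have {}cs : 0 <= c <= s by move: cs; rewrite in_itv/= => /andP[/ltW-> /ltW->].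
have -> : h (x + s *: v + s *: w) - h (x + s *: v) - h (x + s *: w) + h x =
    dphi c * s.
  by rewrite -E /phi scale0r !addr0; ring.
rewrite /dphi.
have ss : 0 <= s <= s by rewrite lexx ltW.
have s00 : 0 <= (0 : R) <= s by rewrite lexx ltW.
have [_ B1] := H _ (small' _ _ cs ss).
have [_ B2] := H _ (small' _ _ cs s00).
have linz r : x + c *: v + r *: w - x = c *: v + r *: w.
  by rewrite -[x + _ + _]addrA addrAC subrr add0r.
rewrite !linz in B1 B2.
have e'k : e / (2 * k) * (s * k) = e / 2 * s.
  by field; rewrite gt_eqF.
have {}B1 := le_trans B1 (ler_wpM2l (ltW e'0) (small _ _ cs ss)).
have {}B2 := le_trans B2 (ler_wpM2l (ltW e'0) (small _ _ cs s00)).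
rewrite e'k in B1 B2.
have linE : 'd hv x (c *: v + s *: w) = 'd hv x (c *: v) + s * 'd hv x w.
  by rewrite linearD; congr (_ + _); rewrite linearZ.
rewrite linE in B1; rewrite scale0r !addr0 in B2; clear linE.
move: B1 B2.
move: ('d hv x w) ('d hv x (c *: v)) (hv (x + c *: v + s *: w))
  (hv (x + c *: v)) (hv x) => f g a b l B1 B2.
have -> : (a - b) * s - s ^+ 2 * f = s * ((a - l - (g + s * f)) - (b - l - g)).
  by ring.
rewrite normrM gtr0_norm// expr2 mulrCA ler_pM2l//.
apply: (le_trans (ler_normB _ _)); lra.
Unshelve. all: by end_near. Qed.

(** Both mixed derivatives are the limit of the same second difference divided
by [s ^+ 2]. *)
Lemma derive_sym (V : normedModType R) (h hv hw : V -> R) x v w :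
  (\forall y \near x, differentiable h y /\ 'd h y v = hv y) ->
  (\forall y \near x, differentiable h y /\ 'd h y w = hw y) ->
  differentiable hv x -> differentiable hw x -> 'D_w hv x = 'D_v hw x.
Proof.
move=> dhv dhw dv dw; rewrite !deriveE//.
apply/eqP; rewrite -subr_eq0 -normr_le0; apply/ler_addgt0Pl => e e0.
rewrite addr0.
have e2 : 0 < e / 2 by rewrite divr_gt0.
near (0 : R)^'+ => s.
have s0 : 0 < s by near: s; exact: nbhs_right_gt.
have H1 : `|h (x + s *: v + s *: w) - h (x + s *: v) - h (x + s *: w) + h x
      - s ^+ 2 * 'd hv x w| <= e / 2 * s ^+ 2.
  by near: s; exact: second_difference.
have H2 : `|h (x + s *: w + s *: v) - h (x + s *: w) - h (x + s *: v) + h x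
      - s ^+ 2 * 'd hw x v| <= e / 2 * s ^+ 2.
  by near: s; exact: second_difference.
rewrite [x + _ + s *: v]addrAC in H2.
set a := 'd _ x w in H1 *; set b := 'd _ x v in H2 *.
rewrite -(@ler_pM2r _ (s ^+ 2)) ?exprn_gt0//.
rewrite -[X in _ * X]ger0_norm ?sqr_ge0// -normrM.
move: H1 H2; rewrite !ler_norml => /andP[? ?] /andP[? ?].
apply/andP; split; lra.
Unshelve. all: by end_near. Qed.
End Calculus.

(** * Smooth maps *)

Section Smooth.
Context {R : realType}.

Lemma smooth_on_cst (V W : normedModType R) (A : set V) (c : W) :
  smooth_on A (fun=> c).
Proof.
move=> k; elim: k c => [|k IH] c /=; first by move=> x _; exact: cvg_cst.
split=> [x _|v]; first exact: differentiable_cst.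
have -> : (fun x : V => 'd (fun=> c) x v) = fun=> 0.
  by apply/funext => x; rewrite diff_cst.
exact: IH.
Qed.

Lemma smooth_on_differentiable (V W : normedModType R) (A : set V) (h : V -> W)
  x : smooth_on A h -> A x -> differentiable h x.
Proof. by move=> /(_ 1%N)[dh _]; exact: dh. Qed.

Lemma smooth_on_diff (V W : normedModType R) (A : set V) (h : V -> W) v :
  smooth_on A h -> smooth_on A (fun x => 'd h x v).
Proof. by move=> sh k; have [_ +] := sh k.+1; exact. Qed.

Lemma near_diffE (V W : normedModType R) (A : set V) (h : V -> W)
    x v : open A -> smooth_on A h -> A x -> \near x, 'd h x v = 'D_v h x.
Proof.
move=> oA sh Ax; have : nbhs x A by exact: open_nbhs_nbhs.
apply: filterS => y Ay; rewrite deriveE//.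
exact: smooth_on_differentiable sh Ay.
Qed.

Lemma derivable_derive (V W : normedModType R) (A : set V) (h : V -> W) x v w :
  open A -> smooth_on A h -> A x -> derivable ('D_v h) x w.
Proof.
move=> oA sh Ax.
apply: near_eq_derivable (near_diffE v oA sh Ax) _.
apply: diff_derivable.
exact: smooth_on_differentiable (smooth_on_diff v sh) Ax.
Qed.

Lemma derive_sym_rV (V : normedModType R) n (A : set V) (h : V -> 'rV[R]_n)
    x v w :
  open A -> smooth_on A h -> A x -> 'D_w ('D_v h) x = 'D_v ('D_w h) x.
Proof.
move=> oA sh Ax.
have nA : nbhs x A by exact: open_nbhs_nbhs.
have dhA y : A y -> differentiable h y by apply: smooth_on_differentiable.
have coordD (k : 'I_n) (f : V -> 'rV[R]_n) y : differentiable f y ->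
    differentiable (fun z => f z 0 k : R) y.
  move=> df; have dc := @differentiable_coord R 1 n (f y) 0 k.
  exact: (differentiable_comp df dc).
have dE k a : \forall y \near x, differentiable (fun z => h z 0 k : R) y /\
    'd (fun z => h z 0 k : R) y a = 'd h y a 0 k.
  apply: filterS nA => y Ay; split; first exact/coordD/dhA.
  rewrite -!deriveE; [|exact: dhA|exact/coordD/dhA].
  by rewrite derive_mx ?mxE//; exact/diff_derivable/dhA.
have ddh a k : differentiable (fun y => 'd h y a 0 k : R) x.
  exact/coordD/(smooth_on_differentiable (smooth_on_diff a sh) Ax).
have E a b k : 'D_b ('D_a h) x 0 k = 'D_b (fun y => 'd h y a 0 k : R) x.
  rewrite derive_mx; last exact: derivable_derive oA sh Ax.
  rewrite mxE; apply: near_eq_derive; apply: filterS nA => y Ay.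
  by rewrite deriveE//; exact: dhA.
suff mixed k : 'D_w ('D_v h) x 0 k = 'D_v ('D_w h) x 0 k.
  by apply/rowP.
apply: etrans (E v w k) (etrans _ (esym (E w v k))).
exact: (derive_sym (dE k v) (dE k w) (ddh v k) (ddh w k)).
Qed.

End Smooth.

(** * Bilinearity of the metric *)

Section InnerTheory.
Context {R : realType} {n : nat}.
Implicit Types (G : 'M[R]_n) (X Y : 'rV[R]_n).

Lemma innerDl G X1 X2 Y : inner G (X1 + X2) Y = inner G X1 Y + inner G X2 Y.
Proof. by rewrite /inner !mulmxDl mxE. Qed.
Lemma innerDr G X Y1 Y2 : inner G X (Y1 + Y2) = inner G X Y1 + inner G X Y2.
Proof. by rewrite /inner linearD /= mulmxDr mxE. Qed.
Lemma innerZl G a X Y : inner G (a *: X) Y = a * inner G X Y.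
Proof. by rewrite /inner -!scalemxAl mxE. Qed.
Lemma innerZr G a X Y : inner G X (a *: Y) = a * inner G X Y.
Proof. by rewrite /inner linearZ /= -!scalemxAr mxE. Qed.
Lemma inner0l G Y : inner G 0 Y = 0.
Proof. by rewrite -(scale0r 0) innerZl mul0r. Qed.
Lemma inner0r G X : inner G X 0 = 0.
Proof. by rewrite -(scale0r 0) innerZr mul0r. Qed.
Lemma innerNl G X Y : inner G (- X) Y = - inner G X Y.
Proof. by rewrite -scaleN1r innerZl mulN1r. Qed.
Lemma innerNr G X Y : inner G X (- Y) = - inner G X Y.
Proof. by rewrite -scaleN1r innerZr mulN1r. Qed.
End InnerTheory.

(** * The Levi-Civita connection along a map *)

Section Pullback.
Context {R : realType} {T : topologicalType} {n m : nat} {A : atlas R T n}.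
Variables (g J : tensor_field A) (Gam : christoffel A).
Hypotheses (hg : is_riemannian g) (hJ : is_endo_field J).
Hypotheses (hGam : is_levi_civita g Gam) (hpar : parallel Gam J).
Variables (j : chart A) (L : 'rV[R]_m -> 'rV[R]_n).

(** The covariant derivative of a vector field [V] along the map [L]; it is
needed because the fields differentiated below, such as ['D_w L], are only
defined on the image of [L] and extend to no given field of the ambient
chart. *)
Definition pull_covd (v : 'rV[R]_m) (V : 'rV[R]_m -> 'rV[R]_n) (u : 'rV[R]_m) :=
  'D_v V u + V u *m conn_form Gam j (L u) ('D_v L u).

Variables (u : 'rV[R]_m).
Hypotheses (dL : differentiable L u) (Lu : cod j (L u)).

Lemma covd_cst x v Y : covd Gam j v (fun=> Y) x = Y *m conn_form Gam j x v.
Proof. by rewrite /covd derive_cst add0r. Qed.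

(** Metric compatibility for constant fields of the chart computes the
derivative of [g] itself, so the chain and product rules yield it for fields
along [L]. *)
Lemma pull_metric v V W : derivable V u v -> derivable W u v ->
  is_derive u v (fun u => inner (g j (L u)) (V u) (W u))
    (inner (g j (L u)) (pull_covd v V u) (W u) +
     inner (g j (L u)) (V u) (pull_covd v W u)).
Proof.
move=> /derivableP dV /derivableP dW.
have dg : differentiable (g j) (L u).
  exact: smooth_on_differentiable (metric_smooth hg j) Lu.
have := is_derive_inner (is_derive_comp_diff v dL dg) dV dW.
set dG := 'D_ _ (g j) _ => H; apply: (is_derive_eq H).
have -> : inner dG (V u) (W u) =
    inner (g j (L u)) (V u *m conn_form Gam j (L u) ('D_v L u)) (W u) +
    inner (g j (L u)) (V u) (W u *m conn_form Gam j (L u) ('D_v L u)).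
  have [_ _ mc] := hGam.
  have := mc j _ _ (smooth_on_cst _ (V u)) (smooth_on_cst _ (W u)) _ Lu
    ('D_v L u).
  rewrite !covd_cst => <-.
  have /derivableP dg' : derivable (g j) (L u) ('D_v L u) := diff_derivable dg.
  have [_ ->] := is_derive_inner dg' (is_derive_cst (V u) (L u) ('D_v L u))
    (is_derive_cst (W u) (L u) ('D_v L u)).
  by rewrite inner0l inner0r !addr0.
by rewrite /pull_covd innerDl innerDr; ring.
Qed.

Lemma derivable_endo v (V : 'rV[R]_m -> 'rV[R]_n) : derivable V u v ->
  derivable (fun w => V w *m J j (L w)) u v.
Proof.
move=> /derivableP dV.
have dJ : differentiable (J j) (L u).
  exact: smooth_on_differentiable (endo_smooth hJ j) Lu.
by have [] := is_derive_mulmx dV (is_derive_comp_diff v dL dJ).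
Qed.

(** Parallelism of [J] against constant fields says that the derivative of [J]
is the commutator with the connection form. *)
Lemma pull_endo v (V : 'rV[R]_m -> 'rV[R]_n) : derivable V u v ->
  pull_covd v (fun w => V w *m J j (L w)) u = pull_covd v V u *m J j (L u).
Proof.
move=> /derivableP dV.
have dJ : differentiable (J j) (L u).
  exact: smooth_on_differentiable (endo_smooth hJ j) Lu.
rewrite /pull_covd.
have [_ ->] := is_derive_mulmx dV (is_derive_comp_diff v dL dJ).
set dJv := 'D_ _ (J j) _.
have := hpar (smooth_on_cst _ (V u)) Lu ('D_v L u).
rewrite covd_cst /covd.
have /derivableP dJ' : derivable (J j) (L u) ('D_v L u) := diff_derivable dJ.
have [_ ->] := is_derive_mulmx (is_derive_cst (V u) (L u) ('D_v L u)) dJ'.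
rewrite mul0mx add0r -/dJv => /eqP; rewrite subr_eq0 => /eqP E.
by rewrite mulmxDl -addrA E.
Qed.

Lemma conn_form_sym x X Y : cod j x ->
  Y *m conn_form Gam j x X = X *m conn_form Gam j x Y.
Proof.
move=> xj; have [_ tf _] := hGam.
have := tf j _ _ (smooth_on_cst _ X) (smooth_on_cst _ Y) x xj.
rewrite !covd_cst /lie_bracket !derive_cst subrr => /eqP.
by rewrite subr_eq0 => /eqP.
Qed.

(** The symmetry of the Hessian of [L] together with that of the Christoffel
symbols. *)
Lemma pull_sym U v w : open U -> smooth_on U L -> U u ->
  pull_covd v ('D_w L) u = pull_covd w ('D_v L) u.
Proof.
move=> oU sL Uu; rewrite /pull_covd (derive_sym_rV _ _ oU sL Uu).
by rewrite (conn_form_sym _ _ Lu).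
Qed.

End Pullback.

Section Core.
Context {R : realType} {T : topologicalType} {n m : nat} {A : atlas R T n}.
Variables (p q : nat) (g J : tensor_field A) (Gam : christoffel A).
Hypotheses (hJ : is_metallic p q g J).
Hypotheses (hGam : is_levi_civita g Gam) (hpar : parallel Gam J).
Variables (j : chart A) (L : 'rV[R]_m -> 'rV[R]_n) (U : set 'rV[R]_m).
Hypotheses (oU : open U) (sL : smooth_on U L).
Hypotheses (LU : forall u, U u -> cod j (L u)).

(** Write A_v for ['D_v L] and B for ['D_z L], and let K be the covariant
derivative of B along [z]. Differentiating the two orthogonality relations
along [z], and using the symmetry of second covariant derivatives and the
parallelism of [J], expresses the derivatives along [v] of <B, B> and <J B, B>
as - 2 <A_v, K> and - 2 <J A_v, K>. The stationarity hypothesis therefore says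
that the linear form <_, K> satisfies <J A_v, K> = l <A_v, K> for [v] in [E].
Applying this twice, J^2 = p J + q forces (l^2 - p l - q) <A_v, K> = 0. *)
Lemma stationary_length (E : set 'rV[R]_m) (z u0 : 'rV[R]_m) (l : R) :
  U u0 ->
  (forall u v, U u -> E v -> inner (g j (L u)) ('D_v L u) ('D_z L u) = 0) ->
  (forall u v, U u -> E v ->
     inner (g j (L u)) ('D_v L u *m J j (L u)) ('D_z L u) = 0) ->
  (forall v, E v ->
     exists2 v', E v' & 'D_v L u0 *m J j (L u0) = 'D_v' L u0) ->
  (forall v, E v ->
    'D_v (fun u => inner (g j (L u)) ('D_z L u *m J j (L u)) ('D_z L u) -
                   l * inner (g j (L u)) ('D_z L u) ('D_z L u)) u0 = 0) ->
  l ^+ 2 != p%:R * l + q%:R ->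
  forall v, E v ->
    'D_v (fun u => inner (g j (L u)) ('D_z L u) ('D_z L u)) u0 = 0.
Proof.
move=> Uu0 orth orthJ inv ext hl.
have hg := metallic_metric hJ; have hE := metallic_endo hJ.
have dL := smooth_on_differentiable sL Uu0.
have cL := LU Uu0.
have nU : nbhs u0 U by exact: open_nbhs_nbhs.
have dD v w : derivable ('D_v L) u0 w by exact: derivable_derive oU sL Uu0.
have dDJ v w : derivable (fun u => 'D_v L u *m J j (L u)) u0 w.
  exact: (derivable_endo hE).
set K := pull_covd Gam j L z ('D_z L) u0.
have sym v : pull_covd Gam j L v ('D_z L) u0 = pull_covd Gam j L z ('D_v L) u0.
  exact: (pull_sym hGam _ _ _ oU sL).
have gsym := @metric_sym _ _ _ _ _ hg _ _ cL.
have Jsym := @metallic_sym _ _ _ _ _ _ _ _ hJ _ _ cL.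
pose G := g j (L u0).
have dlen v : E v -> inner G (pull_covd Gam j L v ('D_z L) u0) ('D_z L u0) =
    - inner G ('D_v L u0) K.
  move=> Ev; rewrite sym.
  have [_] := pull_metric hg hGam dL cL (dD v z) (dD z z).
  rewrite (@near_eq_derive _ _ _ _ (cst 0)); last first.
    by apply: filterS nU => u Uu; rewrite orth.
  by rewrite derive_cst -/K -/G => /esym/eqP; rewrite addr_eq0 => /eqP.
have dlenJ v : E v ->
    inner G (pull_covd Gam j L v ('D_z L) u0 *m J j (L u0)) ('D_z L u0) =
    - inner G ('D_v L u0 *m J j (L u0)) K.
  move=> Ev; rewrite sym.
  have [_] := pull_metric hg hGam dL cL (dDJ v z) (dD z z).
  rewrite (@near_eq_derive _ _ _ _ (cst 0)); last first.
    by apply: filterS nU => u Uu; rewrite orthJ.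
  rewrite (pull_endo hE hpar dL cL (dD v z)).
  by rewrite derive_cst -/K -/G => /esym/eqP; rewrite addr_eq0 => /eqP.
have eigen v : E v -> inner G ('D_v L u0 *m J j (L u0)) K =
    l * inner G ('D_v L u0) K.
  move=> Ev.
  have dN := pull_metric hg hGam dL cL (dD z v) (dD z v).
  have dP := pull_metric hg hGam dL cL (dDJ z v) (dD z v).
  have := ext _ Ev.
  rewrite (@derive_val _ _ _ _ _ _ _ (is_deriveB dP (is_deriveZ l dN))).
  rewrite (pull_endo hE hpar dL cL (dD z v)).
  rewrite [inner _ (_ *m _) (pull_covd _ _ _ _ _ _)]gsym.
  rewrite [inner _ ('D_z L u0) (pull_covd _ _ _ _ _ _)]gsym.
  rewrite -Jsym -/G dlen// dlenJ//.
  have -> (x : R) : l *: x = l * x by [].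
  by move=> ?; lra.
move=> v Ev.
have [_ ->] := pull_metric hg hGam dL cL (dD z v) (dD z v).
rewrite [inner _ ('D_z L u0) (pull_covd _ _ _ _ _ _)]gsym -/G dlen//.
have [v' Ev' Ev'E] := inv _ Ev.
have := eigen _ Ev'; rewrite -Ev'E eigen// -mulmxA (metallic_eq hJ cL).
rewrite mulmxDr -scalemxAr mul_mx_scalar innerDl !innerZl eigen// => H.
have /eqP : (l ^+ 2 - (p%:R * l + q%:R)) * inner G ('D_v L u0) K = 0.
  by rewrite mulrBl expr2 -mulrA -H; ring.
rewrite mulf_eq0 subr_eq0 (negbTE hl)/= => /eqP ->.
by rewrite !oppr0 addr0.
Qed.

End Core.

(** * Linear algebra of slant subspaces *)

Section Slant.
Context {R : realType} {n k : nat}.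
Variables (p q : nat) (G J : 'M[R]_n) (W : 'M[R]_(k, n)) (theta : R).
Hypotheses (q_gt0 : (0 < q)%N).
Hypotheses (Gsym : forall X Y : 'rV[R]_n, inner G X Y = inner G Y X).
Hypotheses (Gpos : forall X : 'rV[R]_n, X != 0 -> 0 < inner G X X).
Hypotheses (J2 : J *m J = p%:R *: J + q%:R%:M).
Hypotheses (Jsym : forall X Y : 'rV[R]_n,
  inner G (X *m J) Y = inner G X (Y *m J)).
Hypotheses (Wfree : row_free W).
Hypotheses (slant : forall X : 'rV[R]_k, X != 0 ->
  subspace_angle G W (X *m W *m J) theta).

Lemma inner_ge0 X : 0 <= inner G X X.
Proof.
have [->|/Gpos/ltW//] := eqVneq X 0.
by rewrite inner0l.
Qed.

Lemma cauchy_schwarz X Y : inner G X Y ^+ 2 <= inner G X X * inner G Y Y.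
Proof.
have [->|/Gpos Y0] := eqVneq Y 0; first by rewrite !inner0r expr0n/= mulr0.
have := inner_ge0 (inner G Y Y *: X - inner G X Y *: Y).
rewrite !(innerDl, innerDr, innerNl, innerNr, innerZl, innerZr) (Gsym Y X).
set a := inner G Y Y in Y0 *; set b := inner G X Y; set c := inner G X X => H.
rewrite -subr_ge0 -(pmulr_rge0 _ Y0).
by apply: (le_trans H); rewrite le_eqVlt; apply/orP; left; apply/eqP; ring.
Qed.

Lemma mulW_neq0 (X : 'rV[R]_k) : X != 0 -> X *m W != 0.
Proof.
apply: contra_neq => XW0; apply: (row_free_inj Wfree).
by rewrite XW0 mul0mx.
Qed.

Lemma mulJ_neq0 (X : 'rV[R]_n) : X != 0 -> X *m J != 0.
Proof.
apply: contra_neq => XJ0.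
have : X *m (J *m J) = 0 by rewrite mulmxA XJ0 mul0mx.
rewrite J2 mulmxDr -scalemxAr XJ0 scaler0 add0r mul_mx_scalar => /eqP.
by rewrite scaler_eq0 pnatr_eq0 -leqn0 leqNgt q_gt0 => /eqP.
Qed.

(** The orthogonal projection of J X onto the row space of [W] has length
cos theta |J X|. The quotient of lengths lies in [0, 1], so that [acos] may be
inverted. *)
Lemma slant_projection (X : 'rV[R]_k) : X != 0 -> exists Y : 'rV[R]_k,
  (forall Z : 'rV[R]_k,
     inner G (X *m W *m J) (Z *m W) = inner G (Y *m W) (Z *m W)) /\
  inner G (Y *m W) (Y *m W) =
    cos theta ^+ 2 * inner G (X *m W *m J) (X *m W *m J).
Proof.
move=> X0; have [w [/submxP[Y wE] worth] thetaE] := slant X0.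
have /Gpos v0 := mulJ_neq0 (mulW_neq0 X0).
set v := X *m W *m J in v0 worth thetaE *.
exists Y; split=> [Z|].
  have := worth (Z *m W) (submxMl _ _).
  by rewrite innerDl innerNl wE => /eqP; rewrite subr_eq0 => /eqP.
have vw : inner G v w = inner G w w.
  have := worth w; rewrite {1}wE submxMl innerDl innerNl => /(_ isT)/eqP.
  by rewrite subr_eq0 => /eqP.
have wv : inner G w w <= inner G v v.
  have := inner_ge0 (v - w).
  rewrite !(innerDl, innerDr, innerNl, innerNr) (Gsym w v) vw.
  by move=> ?; lra.
have nv : 0 < gnorm G v by rewrite sqrtr_gt0.
rewrite -wE thetaE acosK; last first.
  rewrite in_itv/= ler_pdivrMr// mul1r.
  rewrite ler_sqrt ?(ltW v0)// wv andbT.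
  by apply: (le_trans (lerN10 _)); rewrite divr_ge0 ?sqrtr_ge0.
by rewrite expr_div_n !sqr_sqrtr ?inner_ge0// divfK// gt_eqF.
Qed.

Let c2 := cos theta ^+ 2.
Let N (X : 'rV[R]_k) := inner G (X *m W) (X *m W).
Let P (X : 'rV[R]_k) := inner G (X *m W *m J) (X *m W).

Lemma inner_JJ (X : 'rV[R]_n) :
  inner G (X *m J) (X *m J) = p%:R * inner G (X *m J) X + q%:R * inner G X X.
Proof.
rewrite Jsym -mulmxA J2 mulmxDr -scalemxAr mul_mx_scalar innerDr !innerZr.
by rewrite (Gsym X (X *m J)).
Qed.

(** Cauchy-Schwarz for X and the projection of J X. With lambda the ratio
<J X, X> / <X, X> it reads lambda^2 <= c2 (p lambda + q), which confines lambda
between the two roots of x^2 = c2 (p x + q). *)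
Lemma slant_ineq X : X != 0 -> P X ^+ 2 <= c2 * (p%:R * P X + q%:R * N X) * N X.
Proof.
move=> /slant_projection[Y [YX YY]].
by rewrite /P YX (le_trans (cauchy_schwarz _ _))// YY inner_JJ -YX.
Qed.

(** The Gram matrices of <_, _> and <J _, _> on the row space of [W]. *)
Let H := W *m G *m W^T.
Let Q := W *m J *m G *m W^T.

Lemma innerH (X Z : 'rV[R]_k) : inner H X Z = inner G (X *m W) (Z *m W).
Proof. by rewrite /inner /H trmx_mul !mulmxA. Qed.

Lemma innerQ (X Z : 'rV[R]_k) : inner Q X Z = inner G (X *m W *m J) (Z *m W).
Proof. by rewrite /inner /Q trmx_mul !mulmxA. Qed.

Lemma Hpos (X : 'rV[R]_k) : X != 0 -> 0 < inner H X X.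
Proof. by move=> X0; rewrite innerH Gpos// mulW_neq0. Qed.

Lemma H_unit : H \in unitmx.
Proof.
rewrite -row_free_unit -kermx_eq0; apply/rowV0P => X /sub_kermxP XH0.
apply/eqP/negPn/negP => /Hpos; rewrite /inner XH0 mul0mx mxE ltxx//.
Qed.

Lemma innerH_inj (X Y : 'rV[R]_k) :
  (forall Z : 'rV[R]_k, inner H X Z = inner H Y Z) -> X = Y.
Proof.
move=> XY; apply/eqP; rewrite -subr_eq0; apply/negPn/negP => /Hpos.
by rewrite innerDl innerNl XY subrr ltxx.
Qed.

(** [S] is the tangential part of [J] on the row space of [W]. The slant
condition gives the quadratic form |S X|^2 = c2 (p <S X, X> + q |X|^2), whose
polarization is a quadratic equation for [S]. *)
Lemma slant_tangential : exists S : 'M[R]_k,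
  (forall X Z : 'rV[R]_k, inner Q X Z = inner H (X *m S) Z) /\
  S *m S = c2 *: (p%:R *: S + q%:R%:M).
Proof.
pose S := Q *m invmx H; exists S.
have QE X Z : inner Q X Z = inner H (X *m S) Z.
  by rewrite /inner /S mulmxA mulmxKV// H_unit.
split=> //.
have Qsym X Z : inner Q X Z = inner Q Z X.
  by rewrite !innerQ Jsym Gsym.
have Hsym X Z : inner H X Z = inner H Z X.
  by rewrite !innerH Gsym.
have sq X : inner H (X *m S) (X *m S) =
    c2 * (p%:R * inner Q X X + q%:R * inner H X X).
  have [->|/slant_projection[Y [YX YY]]] := eqVneq X 0.
    by rewrite mul0mx !inner0r !mulr0 addr0 mulr0.
  have -> : X *m S = Y.
    by apply: innerH_inj => Z; rewrite -QE innerQ YX innerH.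
  by rewrite innerH YY inner_JJ innerQ innerH.
have pol X Z : inner H (X *m S) (Z *m S) =
    c2 * (p%:R * inner Q X Z + q%:R * inner H X Z).
  have := sq (X + Z); rewrite mulmxDl !(innerDl, innerDr) !sq.
  rewrite (Qsym Z X) (Hsym Z X) (Hsym (Z *m S)) => ?.
  have : 2 * inner H (X *m S) (Z *m S) =
      2 * (c2 * (p%:R * inner Q X Z + q%:R * inner H X Z)) by lra.
  by apply: mulfI; rewrite pnatr_eq0.
apply/row_matrixP => i; rewrite !rowE; apply: innerH_inj => Z.
rewrite mulmxA -QE Qsym QE Hsym pol -scalemxAr mulmxDr -scalemxAr mul_mx_scalar.
by rewrite innerZl innerDl !innerZl -QE.
Qed.

(** [S] satisfies (S - l1) (S - l2) = 0, so that a nonzero vector Z either is an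
eigenvector for [l2] itself or is mapped by S - l2 to one for [l1]. *)
Lemma slant_eigen : (0 < k)%N ->
  exists l X,
    [/\ X != 0, l ^+ 2 = c2 * (p%:R * l + q%:R) & P X = l * N X].
Proof.
move=> k0; have [S [QE S2]] := slant_tangential.
pose Z : 'rV[R]_k := const_mx 1.
have Z0 : Z != 0.
  by apply/rV0Pn; exists (Ordinal k0); rewrite mxE oner_neq0.
have c0 : 0 <= c2 by exact: sqr_ge0.
pose D := c2 ^+ 2 * p%:R ^+ 2 + 4 * c2 * q%:R.
have D0 : 0 <= D.
  apply: addr_ge0; [exact: mulr_ge0 (sqr_ge0 _) (sqr_ge0 _)|].
  exact: mulr_ge0 (mulr_ge0 (ler0n _ 4) c0) (ler0n _ _).
pose l1 := (c2 * p%:R + Num.sqrt D) / 2.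
pose l2 := (c2 * p%:R - Num.sqrt D) / 2.
have l12 : l1 + l2 = c2 * p%:R by rewrite /l1 /l2; field.
have l1l2 : l1 * l2 = - (c2 * q%:R).
  have -> : l1 * l2 = ((c2 * p%:R) ^+ 2 - Num.sqrt D ^+ 2) / 4.
    by rewrite /l1 /l2; field.
  by rewrite sqr_sqrtr// /D; field.
have root1 : l1 ^+ 2 = c2 * (p%:R * l1 + q%:R).
  have -> : c2 * (p%:R * l1 + q%:R) =
      (c2 * p%:R) * l1 - (- (c2 * q%:R)) by ring.
  by rewrite -l12 -l1l2; ring.
have root2 : l2 ^+ 2 = c2 * (p%:R * l2 + q%:R).
  have -> : c2 * (p%:R * l2 + q%:R) =
      (c2 * p%:R) * l2 - (- (c2 * q%:R)) by ring.
  by rewrite -l12 -l1l2; ring.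
have PE X l : X *m S = l *: X -> P X = l * N X.
  by rewrite /P /N -innerQ -innerH QE => ->; rewrite innerZl.
have [X0|X0] := eqVneq (Z *m S - l2 *: Z) 0.
  exists l2, Z; split=> //; apply: PE.
  by apply/eqP; rewrite -subr_eq0 X0.
exists l1, (Z *m S - l2 *: Z); split=> //; apply: PE.
rewrite mulmxBl -scalemxAl -mulmxA S2 -scalemxAr mulmxDr -scalemxAr.
rewrite mul_mx_scalar.
rewrite scalerDr !scalerA -l12 scalerBr scalerA l1l2 scalerDl scaleNr opprK.
by rewrite addrAC addrK.
Qed.

End Slant.

Lemma cos2_lt1 {R : realType} (theta : R) :
  0 < theta < pi / 2 -> cos theta ^+ 2 < 1.
Proof.
move=> /andP[t0 tpi].
rewrite -subr_gt0 -sin2cos2 exprn_gt0// sin_gt0_pi// t0/=.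
by rewrite (lt_trans tpi)// ltr_pdivrMr ?pi_gt0// ltr_pMr ?pi_gt0 ?ltr1n.
Qed.

(** The inequality is (a - l b) (a - l' b) <= 0, where [c * p - l] is the other
root l' of x^2 = c (p x + q); hence a - l b has the sign opposite to l - l'. *)
Lemma root_one_sided {R : realFieldType} (c p q l a b : R) :
  l ^+ 2 = c * (p * l + q) -> 0 <= b -> a ^+ 2 <= c * (p * a + q * b) * b ->
  (-1) ^+ (l < c * p - l)%R * (a - l * b) <= 0.
Proof.
move=> lroot b0 ab; set l' := _ - l.
have {}ab : (a - l * b) * (a - l' * b) <= 0.
  rewrite -subr_le0 in ab; apply: le_trans ab.
  rewrite le_eqVlt; apply/orP; left; apply/eqP.
  have -> : (a - l * b) * (a - l' * b) =
      a ^+ 2 - (c * p) * (a * b) + (l * (c * p) - l ^+ 2) * b ^+ 2.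
    by rewrite /l'; ring.
  by rewrite lroot; ring.
case: (ltP l l') => /= ll'.
  rewrite expr1 mulN1r oppr_le0 leNgt; apply/negP => h1.
  have : 0 < (a - l * b) * (a - l' * b).
    by rewrite nmulr_rgt0// (le_lt_trans _ h1)// lerB// ler_wpM2r// ltW.
  by rewrite ltNge ab.
rewrite expr0 mul1r leNgt; apply/negP => h1.
have : 0 < (a - l * b) * (a - l' * b).
  by rewrite pmulr_rgt0// (lt_le_trans h1)// lerB// ler_wpM2r.
by rewrite ltNge ab.
Qed.

(** The structure equation and the slant equation have no common root when
c < 1 and q > 0: both together give l^2 = c l^2, so that l = 0 and q = 0. *)
Lemma slant_root_neq {R : realFieldType} (c p q l : R) :
  c < 1 -> q != 0 -> l ^+ 2 = c * (p * l + q) -> l ^+ 2 != p * l + q.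
Proof.
move=> c1 q0 lroot; apply/eqP => lE; move: lroot; rewrite -lE => /eqP.
rewrite -subr_eq0 -{1}[l ^+ 2]mul1r -mulrBl mulf_eq0 subr_eq0 (gt_eqF c1)/=.
rewrite sqrf_eq0 => /eqP l0; move: lE.
by rewrite l0 expr0n/= mulr0 add0r => /esym/eqP; rewrite (negbTE q0).
Qed.

(** * Functions with vanishing differential *)

Section LocallyConstant.
Context {R : realType}.

Lemma derive0_ball_cst (V : normedModType R) (h : V -> R) x e w :
  (forall y, ball x e y -> differentiable h y /\ forall v, 'D_v h y = 0) ->
  ball x e w -> h w = h x.
Proof.
move=> H xw.
pose c t := x + t *: (w - x).
have cB (t : R) : 0 <= t <= 1 -> ball x e (c t).
  move=> /andP[t0 t1]; move: xw; rewrite -!ball_normE/= => xw.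
  rewrite /c opprD addrA subrr sub0r normrN normrZ ger0_norm//.
  by rewrite distrC (le_lt_trans _ xw)// ler_piMl.
have dc (t : R) : 0 <= t <= 1 -> is_derive t 1 (h \o c) (cst 0 t).
  move=> /cB/H[dh h0].
  have dct : differentiable (c : R -> V) t by [].
  have := is_derive_comp_diff (U := R) 1 dct dh.
  by rewrite h0.
have cc : {within `[0, 1], continuous (h \o c)}.
  by apply: derivable_within_continuous => t /=; rewrite in_itv/= => /dc[].
have dc' (t : R) : t \in `]0, 1[%R -> is_derive t 1 (h \o c) (cst 0 t).
  by rewrite in_itv/= => /andP[/ltW t0 /ltW t1]; apply: dc; rewrite t0.
have [t _] := MVT ltr01 dc' cc.
have c1 : c 1 = w by rewrite /c scale1r addrC subrK.
have c0 : c 0 = x by rewrite /c scale0r addr0.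
rewrite mul0r /= c1 c0 => /eqP.
by rewrite subr_eq0 => /eqP.
Qed.

Lemma connected_locally_cst (T : topologicalType) (f : T -> R) :
  (forall x, \forall y \near x, f y = f x) ->
  forall x y, connected_component [set: T] x y -> f x = f y.
Proof.
move=> loc x y [C [Cx _ cC] Cy].
have oF (P : set R) : open [set z | P (f z)].
  by rewrite openE => z Pz; apply: filterS (loc z) => t /= ->.
have : C `&` [set z | f z = f x] = C.
  apply: cC.
  - by exists x.
  - by exists [set z | f z = f x] => //; exact: (oF [set r | r = f x]).
  - exists [set z | f z = f x] => //; rewrite -[X in closed X]setCK.
    by apply: open_closedC; exact: (oF [set r | r <> f x]).
by move=> CE; have := Cy; rewrite -CE => -[_ ->].
Qed.

(** Charts turn a vanishing differential into local constancy. *)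
Lemma derive0_component_cst (T : topologicalType) n (A : atlas R T n)
    (f : T -> R) :
  is_manifold A -> smooth_fun A f ->
  (forall (i : chart A) (u v : 'rV[R]_n), cod i u ->
    'D_v (fun w => f (point A i w) : R) u = 0) ->
  forall x y, connected_component [set: T] x y -> f x = f y.
Proof.
move=> hA sf df; apply: connected_locally_cst => x.
have [i ix] := chart_cover hA x.
have cx : cod i (coord A i x) by exists x.
have /nbhs_ballP[e /= e0 He] : nbhs (coord A i x) (cod i).
  by apply: open_nbhs_nbhs; split=> //; exact: chart_cod_open.
have Bx : nbhs x (coord A i @^-1` ball (coord A i x) e).
  by apply: (chart_continuous hA ix); exact: nbhsx_ballx.
have Dx : nbhs x (dom A i).
  by apply: open_nbhs_nbhs; split=> //; exact: chart_dom_open.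
apply: filterS2 Bx Dx => y yB yD.
rewrite -(chart_inverse hA yD) -(chart_inverse hA ix).
apply: (derive0_ball_cst (h := fun w => f (point A i w)) _ yB) => w /He wA.
by split=> [|v]; [exact: smooth_on_differentiable (sf i) wA|exact: df].
Qed.

End LocallyConstant.

(** * The warped product *)

Section Product.
Context {R : realType} {T1 T2 : topologicalType} {n1 n2 : nat}.
Context {A1 : atlas R T1 n1} {A2 : atlas R T2 n2}.
Let A := prod_atlas A1 A2.

Lemma prod_codE (i : chart A) u :
  cod i u <-> cod i.1 (lsubmx u) /\ cod i.2 (rsubmx u).
Proof.
split=> [[[x1 x2] [/= d1 d2] <-]|[[x1 d1 e1] [x2 d2 e2]]].
  by rewrite row_mxKl row_mxKr; split; [exists x1|exists x2].
by exists (x1, x2) => //=; rewrite e1 e2 hsubmxK.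
Qed.

Lemma local_dom_open (S : topologicalType) n (B : atlas R S n)
    (F : T1 * T2 -> S) (i : chart A) (j : chart B) :
  is_manifold A1 -> is_manifold A2 -> is_manifold B -> continuous F ->
  open (local_dom F i j).
Proof.
move=> h1 h2 hB cF; rewrite openE => u [/prod_codE[u1 u2] uj].
have n1' : nbhs u [set w | cod i.1 (lsubmx w)].
  have : nbhs (lsubmx u) (cod i.1).
    by apply: open_nbhs_nbhs; split=> //; exact: chart_cod_open.
  by move/(@continuous_lsubmx R 1 n1 n2 u).
have n2' : nbhs u [set w | cod i.2 (rsubmx w)].
  have : nbhs (rsubmx u) (cod i.2).
    by apply: open_nbhs_nbhs; split=> //; exact: chart_cod_open.
  by move/(@continuous_rsubmx R 1 n1 n2 u).
have n3 : nbhs u [set w | dom B j (F (point A i w))].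
  have c1 : (fun w : 'rV[R]_(n1 + n2) => point A1 i.1 (lsubmx w)) @ u -->
      point A1 i.1 (lsubmx u).
    apply: (@continuous_comp _ _ _ lsubmx (point A1 i.1) u).
      exact: continuous_lsubmx.
    exact: (chart_inverse_continuous h1 u1).
  have c2 : (fun w : 'rV[R]_(n1 + n2) => point A2 i.2 (rsubmx w)) @ u -->
      point A2 i.2 (rsubmx u).
    apply: (@continuous_comp _ _ _ rsubmx (point A2 i.2) u).
      exact: continuous_rsubmx.
    exact: (chart_inverse_continuous h2 u2).
  have c3 : point A i w @[w --> u] --> point A i u.
    exact: cvg_pair c1 c2.
  have := cvg_comp _ _ c3 (cF (point A i u)); apply.
  by apply: open_nbhs_nbhs; split=> //; exact: chart_dom_open.
apply: filterS3 n1' n2' n3 => w w1 w2 w3; split=> //.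
by apply/prod_codE.
Qed.

Lemma warped_inner (g1 : tensor_field A1) (g2 : tensor_field A2) (f : T1 -> R)
    (i : chart A) u X1 X2 Y1 Y2 :
  inner (warped_metric g1 g2 f i u) (row_mx X1 X2) (row_mx Y1 Y2) =
  inner (g1 i.1 (lsubmx u)) X1 Y1 +
  f (point A1 i.1 (lsubmx u)) ^+ 2 * inner (g2 i.2 (rsubmx u)) X2 Y2.
Proof.
rewrite /inner /warped_metric mul_row_block !mulmx0 addr0 add0r tr_row_mx.
rewrite mul_row_col mxE; congr (_ + _).
by rewrite -scalemxAr -scalemxAl mxE.
Qed.

(** Along a direction tangent to the first factor only the warping function
varies in f^2 g2(Z, Z), whose derivative is 2 f f' g2(Z, Z). *)
Lemma warped_length_derivative (g1 : tensor_field A1) (g2 : tensor_field A2)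
    (f : T1 -> R) (i1 : chart A1) (i2 : chart A2) (x X : 'rV[R]_n1)
    (y Z : 'rV[R]_n2) :
  is_riemannian g2 -> smooth_fun A1 f -> (forall x, 0 < f x) ->
  cod i1 x -> cod i2 y -> Z != 0 ->
  'D_(row_mx X 0) (fun u => inner (warped_metric g1 g2 f ((i1, i2) : chart A) u)
                      (row_mx 0 Z) (row_mx 0 Z)) (row_mx x y) = 0 ->
  'D_X (fun w => f (point A1 i1 w) : R) x = 0.
Proof.
move=> hg2 hf f_gt0 cx cy Z0 DN.
pose u0 : 'rV[R]_(n1 + n2) := row_mx x y.
pose v0 : 'rV[R]_(n1 + n2) := row_mx X 0.
pose ff w : R := f (point A1 i1 w).
pose k := inner (g2 i2 y) Z Z.
have k0 : 0 < k by exact: metric_pos hg2 _ _ cy _ Z0.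
have Dl : is_derive u0 v0 (ff \o lsubmx) ('D_X ff x).
  have dl : differentiable (lsubmx : 'rV[R]_(n1 + n2) -> _) u0.
    exact: differentiable_lsubmx.
  have dff : differentiable ff (lsubmx u0).
    by rewrite row_mxKl; exact: smooth_on_differentiable (hf i1) cx.
  have := is_derive_comp_diff v0 dl dff.
  rewrite (deriveE _ dl) diff_lin; last exact: continuous_lsubmx.
  by rewrite /= !row_mxKl.
have Dr : is_derive u0 v0 (g2 i2 \o rsubmx) 0.
  have dr : differentiable (rsubmx : 'rV[R]_(n1 + n2) -> _) u0.
    exact: differentiable_rsubmx.
  have dg2 : differentiable (g2 i2) (rsubmx u0).
    rewrite row_mxKr.
    exact: smooth_on_differentiable (metric_smooth hg2 i2) cy.
  have := is_derive_comp_diff v0 dr dg2.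
  rewrite (deriveE _ dr) diff_lin; last exact: continuous_rsubmx.
  by rewrite /= !row_mxKr derive0.
pose K (u : 'rV[R]_(n1 + n2)) : R := inner (g2 i2 (rsubmx u)) Z Z.
have DK : is_derive u0 v0 K 0.
  have dZ := is_derive_cst Z u0 v0.
  apply: (is_derive_eq (is_derive_inner Dr dZ dZ)).
  by rewrite inner0l inner0r !addr0 /inner mulmx0 mul0mx mxE.
move: DN; rewrite (_ : (fun u => _) = (ff \o lsubmx) * (ff \o lsubmx) * K);
  last by apply/funext => u; rewrite warped_inner inner0l add0r.
rewrite (@derive_val _ _ _ _ _ _ _ (is_deriveM (is_deriveM Dl Dl) DK)).
rewrite scaler0 add0r /=.
have -> : K u0 = k by rewrite /K row_mxKr.
have -> : ff (lsubmx u0) = f (point A1 i1 x) by rewrite row_mxKl.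
move=> /eqP; rewrite scaler_eq0 (gt_eqF k0)/= -scalerDl scaler_eq0.
have := f_gt0 (point A1 i1 x).
set a := f _ => a0.
by rewrite gt_eqF ?addr_gt0//= => /eqP.
Qed.

End Product.

(** The local form of the theorem: near a point (x, y) the immersion is read in
charts, and a direction Z tangent to the second factor is chosen at that point
so that <J Z, Z> = l <Z, Z> with [l] a root of the slant equation. Then
<J Z, Z> - l <Z, Z> has an extremum there, and [stationary_length] applies to
the directions tangent to the first factor. *)
Lemma warping_derivative (R : realType) (p q : nat) (hq : (0 < q)%N)
    (nbar : nat) (Tbar : topologicalType) (Abar : atlas R Tbar nbar)
    (hMbar : is_manifold Abar)
    (gbar J : tensor_field Abar) (hJ : locally_metallic p q gbar J)
    (n1 n2 : nat) (hn2 : (0 < n2)%N)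
    (T1 T2 : topologicalType) (A1 : atlas R T1 n1) (A2 : atlas R T2 n2)
    (hM1 : is_manifold A1) (hM2 : is_manifold A2)
    (g1 : tensor_field A1) (g2 : tensor_field A2)
    (hg2 : is_riemannian g2)
    (f : T1 -> R) (hf : smooth_fun A1 f) (hf0 : forall x, 0 < f x)
    (F : T1 * T2 -> Tbar)
    (hF : isometric_immersion F (warped_metric g1 g2 f) gbar)
    (hT : invariant_dist F J (tangent_fst A1 A2))
    (theta : R) (htheta : 0 < theta < pi / 2)
    (hS : slant_dist F gbar J (tangent_snd A1 A2) theta)
    (i1 : chart A1) (x X1 : 'rV[R]_n1) : cod i1 x ->
  'D_X1 (fun w => f (point A1 i1 w) : R) x = 0.
Proof.
move=> cx.
(* Any point of the second factor will do. *)
have [y _] := manifold_nonempty hM2.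
have [i2 i2y] := chart_cover hM2 y.
pose i : chart (prod_atlas A1 A2) := (i1, i2).
pose u0 := row_mx x (coord A2 i2 y).
have cu0 : cod i u0.
  by apply/prod_codE; rewrite row_mxKl row_mxKr; split=> //; exists y.
have [j ju0] := chart_cover hMbar (F (point (prod_atlas A1 A2) i u0)).
set L := local_rep F i j; set U := local_dom F i j.
have Uu0 : U u0 by [].
have [[[cF sF] immF] isoF] := hF.
have oU : open U by exact: local_dom_open.
have sL : smooth_on U L := sF i j.
have LU u : U u -> cod j (L u).
  by move=> [_ uj]; exists (F (point (prod_atlas A1 A2) i u)).
have [hmet [Gam hGam hpar]] := hJ.
have hgbar := metallic_metric hmet.
have dLE u v : U u -> 'D_v L u = v *m dmap F i j u.
  move=> Uu; rewrite deriveEjacobian//.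
  exact: smooth_on_differentiable sL Uu.
have nU : nbhs u0 U by exact: open_nbhs_nbhs.
pose E := [set v : 'rV[R]_(n1 + n2) | exists X, v = row_mx X 0].
have orth u v Z : U u -> E v ->
    inner (gbar j (L u)) ('D_v L u) ('D_(row_mx 0 Z) L u) = 0.
  move=> Uu [X ->]; rewrite !dLE// -(isoF i j u Uu) warped_inner.
  by rewrite inner0l inner0r mulr0 addr0.
have inv u v : U u -> E v ->
    exists2 v', E v' & 'D_v L u *m J j (L u) = 'D_v' L u.
  move=> Uu [X ->].
  have /eqmxP DD := hT i j u Uu.
  have : ((X *m row_mx 1%:M 0 *m dmap F i j u) *m J j (L u) <=
      row_mx (1%:M : 'M[R]_n1) (0 : 'M[R]_(n1, n2)) *m dmap F i j u)%MS.
    by rewrite -DD -!mulmxA submxMl.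
  move=> /submxP[X' X'E]; exists (row_mx X' 0); first by exists X'.
  rewrite !dLE//; move: X'E.
  by rewrite !mulmxA !mul_mx_row !mulmx1 !mulmx0.
pose W u : 'M[R]_(n2, nbar) := row_mx 0 1%:M *m dmap F i j u.
have WE u Z : U u -> Z *m W u = 'D_(row_mx 0 Z) L u.
  by move=> Uu; rewrite dLE// /W mulmxA mul_mx_row mulmx0 mulmx1.
have Wfree u : U u -> row_free (W u).
  move=> /(immF i j) free; rewrite /row_free mxrankMfree//.
  apply/row_freeP; exists (col_mx 0 1%:M).
  by rewrite mul_row_col mul0mx add0r mulmx1.
have slant u (Z : 'rV[R]_n2) : U u -> Z != 0 ->
    subspace_angle (gbar j (L u)) (W u) (Z *m W u *m J j (L u)) theta.
  move=> Uu Z0; rewrite (_ : Z *m W u = row_mx 0 Z *m dmap F i j u); last first.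
    by rewrite WE// dLE.
  apply: hS => //.
    rewrite /tangent_snd; apply/submxP; exists Z.
    by rewrite mul_mx_row mulmx0 mulmx1.
  by apply: contra_neq Z0 => /(congr1 rsubmx); rewrite row_mxKr linear0.
have gsym u (Uu : U u) := @metric_sym _ _ _ _ _ hgbar _ _ (LU _ Uu).
have gpos u (Uu : U u) := @metric_pos _ _ _ _ _ hgbar _ _ (LU _ Uu).
have Jsym u (Uu : U u) := @metallic_sym _ _ _ _ _ _ _ _ hmet _ _ (LU _ Uu).
have J2 u (Uu : U u) := metallic_eq hmet (LU _ Uu).
(* The direction Z and the root l are fixed at u0; in a neighbourhood, P - l N
   keeps a constant sign and it vanishes at u0. *)
have [l [Z [Z0 lroot]]] := slant_eigen hq (gsym _ Uu0) (gpos _ Uu0) (J2 _ Uu0)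
  (Jsym _ Uu0) (Wfree _ Uu0) (fun Z => slant u0 Z Uu0) hn2.
rewrite WE// => eig.
pose N u := inner (gbar j (L u)) ('D_(row_mx 0 Z) L u) ('D_(row_mx 0 Z) L u).
pose P u :=
  inner (gbar j (L u)) ('D_(row_mx 0 Z) L u *m J j (L u)) ('D_(row_mx 0 Z) L u).
have ineq u : U u ->
    P u ^+ 2 <= cos theta ^+ 2 * (p%:R * P u + q%:R * N u) * N u.
  move=> Uu; have := slant_ineq hq (gsym _ Uu) (gpos _ Uu) (J2 _ Uu)
    (Jsym _ Uu) (Wfree _ Uu) (fun Z => slant u Z Uu) Z0.
  by rewrite WE.
have Nge0 u : U u -> 0 <= N u.
  by move=> Uu; exact: (inner_ge0 (gpos _ Uu)).
have dL u v w : U u -> derivable ('D_v L) u w.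
  by move=> Uu; exact: derivable_derive oU sL Uu.
have Ldiff u : U u -> differentiable L u := smooth_on_differentiable sL.
have DN v : derivable N u0 v.
  by have [] := pull_metric hgbar hGam (Ldiff _ Uu0) (LU _ Uu0)
    (dL u0 (row_mx 0 Z) v Uu0) (dL u0 (row_mx 0 Z) v Uu0).
have DP v : derivable P u0 v.
  have dB := dL u0 (row_mx 0 Z) v Uu0.
  have dJ :=
    derivable_endo (metallic_endo hmet) (Ldiff _ Uu0) (LU _ Uu0) dB.
  by have [] := pull_metric hgbar hGam (Ldiff _ Uu0) (LU _ Uu0) dJ dB.
have ext v : 'D_v (fun u => P u - l * N u) u0 = 0.
  apply: (derive_extremum (s := (l < cos theta ^+ 2 * p%:R - l)%R)).
  - by apply: derivableB => //; exact: derivableZ.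
  - apply: filterS nU => u Uu.
    exact: root_one_sided lroot (Nge0 u Uu) (ineq u Uu).
  - by rewrite /P /N eig subrr.
have lneq : l ^+ 2 != p%:R * l + q%:R.
  apply: slant_root_neq (cos2_lt1 htheta) _ lroot.
  by rewrite pnatr_eq0 -leqn0 leqNgt hq.
have DN0 : 'D_(row_mx X1 0) N u0 = 0.
  apply: (stationary_length hmet hGam hpar oU sL LU (E := E)
    (l := l)) => //.
  - by move=> u v Uu Ev; exact: orth.
  - move=> u v Uu /(inv u _ Uu)[v' Ev' ->]; exact: orth.
  - by move=> v Ev; exact: inv.
  - by exists X1.
apply: (@warped_length_derivative _ _ _ _ _ _ _ g1 g2 f i1 i2 x X1 _ Z) => //.
  by exists y.
rewrite -/u0 -[RHS]DN0; apply: near_eq_derive; apply: filterS nU => u Uu.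
by rewrite /N !dLE// (isoF i j u Uu).
Qed.

Unset Implicit Arguments.

Theorem theorem2 (R : realType) (p q : nat) (hp : (0 < p)%N) (hq : (0 < q)%N)
    (nbar : nat) (Tbar : topologicalType) (Abar : atlas R Tbar nbar)
    (hMbar : is_manifold Abar)
    (gbar J : tensor_field Abar) (hJ : locally_metallic p q gbar J)
    (n1 n2 : nat) (hn1 : (0 < n1)%N) (hn2 : (0 < n2)%N)
    (T1 T2 : topologicalType) (A1 : atlas R T1 n1) (A2 : atlas R T2 n2)
    (hM1 : is_manifold A1) (hM2 : is_manifold A2)
    (g1 : tensor_field A1) (g2 : tensor_field A2)
    (hg1 : is_riemannian g1) (hg2 : is_riemannian g2)
    (f : T1 -> R) (hf : smooth_fun A1 f) (hf0 : forall x, 0 < f x)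
    (F : T1 * T2 -> Tbar)
    (hF : isometric_immersion F (warped_metric g1 g2 f) gbar)
    (hT : invariant_dist F J (tangent_fst A1 A2))
    (theta : R) (htheta : 0 < theta < pi / 2)
    (hS : slant_dist F gbar J (tangent_snd A1 A2) theta) :
  forall x y : T1, connected_component [set: T1] x y -> f x = f y.
Proof.
apply: (derive0_component_cst hM1 hf) => i u v ui.
exact: (warping_derivative hq hMbar hJ hn2 hM1 hM2 hg2 hf hf0 hF hT htheta hS).
Qed.
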